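(* Let $n\ge 1$ and $p\ge 1$ be integers. Let $T\bar{\omega}_{p-1}\in\Omega^{p}(PT^n(p-1))$ be the form $$T\bar{\omega}_{p-1}= (-1)^{\frac{p(p+1)}{2}}\,\frac{1}{p!}\left(\frac{1}{2\pi}\right)^p\sum_{k=1}^n d\theta^0_k\wedge d\theta^1_k\wedge\cdots\wedge d\theta^{p-1}_k .$$ Then $T\bar{\omega}_{p-1}$ is the Chern-Simons form of the $p$-th Chern character of the universal torus bundle; that is, in the total complex $\Omega^*(PT^n)$, $$(d'+d'')\,T\bar{\omega}_{p-1}=\bar{\omega}_p ,$$ where $\bar{\omega}_p\in\Omega^p(PT^n(p))$ is the cocycle $$\bar{\omega}_{p}= (-1)^{\frac{p(p-1)}{2}}\,\frac{1}{p!}\left(\frac{1}{2\pi}\right)^p\sum_{k=1}^n\ \prod_{s=0}^{p-1}\left(d\theta^s_k-d\theta^{s+1}_k\right)$$ corresponding to the $p$-th Chern character of the universal torus bundle (the product is the wedge product taken in increasing order of $s$).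
   Context: For a Lie group $G$, $PG$ is the simplicial manifold with $PG(q)=G^{q+1}\ni(g_0,\dots,g_q)$ and face operators $\bar{\varepsilon}_i:PG(q)\to PG(q-1)$, $\bar{\varepsilon}_i(g_0,\dots,g_q)=(g_0,\dots,g_{i-1},g_{i+1},\dots,g_q)$, $0\le i\le q$. The double complex is $\Omega^{q,r}(PG)=\Omega^r(PG(q))$ (smooth differential forms), with $d'=\sum_{i=0}^{q+1}(-1)^i\bar{\varepsilon}_i^*:\Omega^r(PG(q))\to\Omega^r(PG(q+1))$ and $d''=(-1)^q\times$(exterior differential) on $\Omega^r(PG(q))$; $\Omega^*(PG)$ is its total complex with differential $d'+d''$. Here $G=T^n$ is the $n$-torus of diagonal unitary $n\times n$ matrices. The $s$-th factor of $PT^n(q)$ is written $g_s=\mathrm{diag}(\exp(i\theta^s_1),\dots,\exp(i\theta^s_n))$, $s=0,\dots,q$, so that $d\theta^s_k$ are globally defined closed real 1-forms on $PT^n(q)$. A Chern-Simons form of a cocycle in $\Omega^*(PG)$ is a cochain of total degree one less whose image under $d'+d''$ is that cocycle. *)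

(* Defs.v *)
From HB Require Import structures.
From mathcomp Require Import all_boot all_order all_algebra all_fingroup.
From mathcomp Require Import spectral complex.
From mathcomp Require Import all_classical all_reals all_analysis.

Set Implicit Arguments.
Unset Strict Implicit.
Unset Printing Implicit Defensive.

Import Order.TTheory GRing.Theory Num.Theory.
Import numFieldNormedType.Exports.

Local Open Scope classical_set_scope.
Local Open Scope ring_scope.
Local Open Scope complex_scope.

Section Torus.
Variables (R : realType) (n : nat).

Definition torus := {A : 'M[R[i]]_n | is_diag_mx A && (A \is unitarymx)}.

Definition cis (t : R) : R[i] := cos t +i* sin t.

Lemma torus_exp_subproof (a : 'rV[R]_n) :
  let A := diag_mx (map_mx cis a) in is_diag_mx A && (A \is unitarymx).
Proof.
rewrite /= diag_mx_is_diag; apply/unitarymxP.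
rewrite tr_diag_mx map_diag_mx mulmx_diag -diag_const_mx; congr diag_mx.
apply/rowP => k; rewrite !mxE /cis.
apply/eqP; rewrite eq_complex /= mulrN opprK -!expr2 cos2Dsin2 eqxx /=.
by rewrite mulrN mulrC addNr eqxx.
Qed.

Definition torus_exp (a : 'rV[R]_n) : torus :=
  exist _ (diag_mx (map_mx cis a)) (torus_exp_subproof a).

Lemma torus_mul_subproof (A B : torus) :
  let C := sval A *m sval B in is_diag_mx C && (C \is unitarymx).
Proof.
case: A B => [A /andP[dA uA]] [B /andP[dB uB]] /=.
rewrite mul_unitarymx // andbT.
have [a ->] := diag_mxP _ dA; have [b ->] := diag_mxP _ dB.
by rewrite mulmx_diag diag_mx_is_diag.
Qed.

Definition torus_mul (A B : torus) : torus :=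
  exist _ (sval A *m sval B) (torus_mul_subproof A B).

Definition PT (q : nat) := 'I_q.+1 -> torus.

(* The Lie algebra of PT q, hence by translation the tangent space at every
   point, is identified with real (q+1) x n matrices: v stands for the vector
   sum_(s, k) v s k * d/dtheta^s_k. *)
Definition tangent (q : nat) := 'M[R]_(q.+1, n).

(* The angle coordinates: PT_coord is the universal covering map, a local
   diffeomorphism, with (PT_coord a) s = diag(exp(i a_(s,1)), ...). *)
Definition PT_coord q (a : tangent q) : PT q := fun s => torus_exp (row s a).

Definition PT_flow q (g : PT q) (v : tangent q) : PT q :=
  fun s => torus_mul (g s) (PT_coord v s).

Definition face q (i : 'I_q.+2) (g : PT q.+1) : PT q := fun j => g (lift i j).

Definition dface q (i : 'I_q.+2) (v : tangent q.+1) : tangent q := row' i v.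

Lemma PT_flow_coord q (a v : tangent q) :
  PT_flow (PT_coord a) v = PT_coord (a + v).
Proof.
apply/funext => s; apply: eq_exist; rewrite /= mulmx_diag; congr diag_mx.
apply/rowP => k; rewrite !mxE /cis cosD sinD.
apply/eqP; rewrite eq_complex /= eqxx /=.
by rewrite addrC.
Qed.

(* dface i is the differential of face i in the invariant framings. *)
Lemma face_flow q (i : 'I_q.+2) (g : PT q.+1) (v : tangent q.+1) :
  face i (PT_flow g v) = PT_flow (face i g) (dface i v).
Proof.
apply/funext => s; rewrite /face /PT_flow /PT_coord /dface; congr torus_mul.
by congr torus_exp; apply/rowP => k; rewrite !mxE.
Qed.

Fixpoint Ck q (k : nat) (f : tangent q -> R) : Prop :=
  match k with
  | 0 => continuous f
  | k'.+1 => continuous f /\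
      forall v, (forall a, derivable f a v) /\ Ck k' (fun a => 'D_v f a)
  end.

Definition PT_smooth q (f : PT q -> R) : Prop :=
  forall k, Ck k (f \o @PT_coord q).

Definition PT_derive q (v : tangent q) (f : PT q -> R) (g : PT q) : R :=
  derive1 (fun t : R => f (PT_flow g (t *: v))) 0.

(* A preform assigns to each point a real function of r tangent vectors; the
   differential r-forms are the smooth alternating multilinear ones. *)
Definition preform (q r : nat) := PT q -> ('I_r -> tangent q) -> R.

Definition subst_vec q r (v : 'I_r -> tangent q) (i : 'I_r) (x : tangent q) :=
  fun j => if j == i then x else v j.

Definition multilinear_form q r (w : preform q r) : Prop :=
  forall g v i (c : R) (x y : tangent q),
    w g (subst_vec v i (c *: x + y)) =
    c * w g (subst_vec v i x) + w g (subst_vec v i y).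

Definition alternating_form q r (w : preform q r) : Prop :=
  forall g v (i j : 'I_r), i != j -> v i = v j -> w g v = 0.

Definition smooth_form q r (w : preform q r) : Prop :=
  forall v, PT_smooth (fun g => w g v).

Definition Omega (q r : nat) : set (preform q r) :=
  [set w | [/\ multilinear_form w, alternating_form w & smooth_form w]].

Definition dtheta q (s : 'I_q.+1) (k : 'I_n) : preform q 1 :=
  fun _ v => v ord0 s k.

Definition wedge q r s (w : preform q r) (w' : preform q s) :
    preform q (r + s) :=
  fun g v => (r`! * s`!)%:R^-1 *
    \sum_(p : 'S_(r + s)) (-1) ^+ p *
      w g (fun i => v (p (lshift s i))) * w' g (fun j => v (p (rshift r j))).

Fixpoint wedge_prod q p : ('I_p -> preform q 1) -> preform q p :=
  match p with
  | 0 => fun _ _ _ => 1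
  | p'.+1 => fun w =>
      wedge (w ord0) (wedge_prod (fun s : 'I_p' => w (lift ord0 s)))
  end.

(* Invariant formula for the exterior differential, evaluated on
   translation-invariant vector fields: these commute, so there are no bracket
   terms. *)
Definition ext_diff q r (w : preform q r) : preform q r.+1 :=
  fun g v => \sum_(i < r.+1) (-1) ^+ i *
    PT_derive (v i) (fun h => w h (fun j => v (lift i j))) g.

Definition face_pullback q r (i : 'I_q.+2) (w : preform q r) :
    preform q.+1 r :=
  fun g v => w (face i g) (fun j => dface i (v j)).

Definition d' q r (w : preform q r) : preform q.+1 r :=
  \sum_(i < q.+2) (-1) ^+ i *: face_pullback i w.

Definition d'' q r (w : preform q r) : preform q r.+1 :=
  (-1) ^+ q *: ext_diff w.

(* Elements of the total complex are families (c q r) indexed by bidegree. *)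
Definition total_family := forall q r, preform q r.

Definition total_zero : total_family := fun _ _ => 0.

Definition single q r (w : preform q r) : total_family := fun q' r' =>
  if (q, r) =P (q', r') is ReflectT e
  then ecast qr (preform qr.1 qr.2) e w else 0.

Definition cochain (m : nat) (c : total_family) : Prop :=
  (forall q r, Omega (c q r)) /\ (forall q r, (q + r)%N != m -> c q r = 0).

Definition D (c : total_family) : total_family := fun q r =>
  (match q return preform q r with 0 => 0 | q'.+1 => d' (c q' r) end) +
  (match r return preform q r with 0 => 0 | r'.+1 => d'' (c q r') end).

Definition cocycle (m : nat) (c : total_family) : Prop :=
  cochain m c /\ D c = total_zero.

Definition chern_simons_form (m : nat) (c t : total_family) : Prop :=
  [/\ cocycle m.+1 c, cochain m t & D t = c].

Definition omega_bar (p : nat) : preform p p :=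
  ((-1) ^+ (p * (p - 1))./2 * (p`!)%:R^-1 * (1 / (2 * pi)) ^+ p) *:
  \sum_(k < n) wedge_prod (fun s : 'I_p =>
    dtheta (widen_ord (leqnSn p) s) k - dtheta (lift ord0 s) k).

Definition T_omega_bar (p : nat) : preform p.-1 p :=
  ((-1) ^+ (p * (p + 1))./2 * (p`!)%:R^-1 * (1 / (2 * pi)) ^+ p) *:
  \sum_(k < n) wedge_prod (fun s : 'I_p =>
    dtheta (widen_ord (leqSpred p) s) k).

End Torus.

Arguments single {R n q r} w _ _ : rename.
Arguments D {R n} c _ _ : rename.
Arguments omega_bar : clear implicits.
Arguments T_omega_bar : clear implicits.

(* Main.v *)
Require Import Defs.
From HB Require Import structures.
From mathcomp Require Import all_boot all_order all_algebra all_fingroup.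
From mathcomp Require Import all_classical all_reals all_analysis.

Set Implicit Arguments.
Unset Strict Implicit.
Unset Printing Implicit Defensive.

Import Order.TTheory GRing.Theory Num.Theory.
Import numFieldNormedType.Exports.

Local Open Scope ring_scope.

(** Both forms are determinants. Fix [k] and tangent vectors [v_1, ..., v_r] of
    [PT q], and let [N_k] be the matrix with entries [dtheta^s_k (v_j)], whose
    rows are indexed by the factors [s = 0, ..., q]. A wedge product of 1-forms
    evaluates to the determinant of their values ([wedge_prod_det]), so the
    [k]-th summand of the Chern-Simons form is [det N_k], for a square [N_k],
    and that of the Chern character is the determinant of the differences of
    consecutive rows of an [N_k] with one row more than columns.

    A face map of [PT] forgets a factor, that is, it deletes a row of [N_k].
    Hence [d'] of the first form has the summand
    [\sum_i (-1)^i det (row' i N_k)], the Laplace expansion of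
    [det (1 | N_k)] along an added first column of ones ([det_border1]).
    Subtracting from each row of [(1 | N_k)] the following one leaves a single
    [1] in that column, in the last row, and cofactor expansion gives
    [det (1 | N_k) = (-1)^p det (row_diff N_k)] ([det_row_diff]). The sign
    [(-1)^p] is the ratio of the signs [(-1)^(p(p+1)/2)] and
    [(-1)^(p(p-1)/2)] of the two forms, so [d'] of the first is the second
    ([d'_T_omega_bar]).

    The second form is [d']-closed because the same expansion turns the
    alternating sum of its face pullbacks into [det (1 | 1 | N_k)], which has
    two equal columns ([sum_det_border1_row']). Finally [d''] kills both forms,
    because their coefficients in the [dtheta^s_k] are constant
    ([d''_invariant]). *)

(** * Determinants of bordered and of row-difference matrices *)

Section Determinants.
Variable R : comNzRingType.

Definition border1 a b (M : 'M[R]_(a, b)) : 'M[R]_(a, b.+1) :=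
  \matrix_(i, j) oapp (M i) 1 (unlift ord0 j).

Lemma border1_0 a b (M : 'M[R]_(a, b)) i : border1 M i ord0 = 1.
Proof. by rewrite mxE unlift_none. Qed.

Lemma border1_lift a b (M : 'M[R]_(a, b)) i j :
  border1 M i (lift ord0 j) = M i j.
Proof. by rewrite mxE liftK. Qed.

(** The added column is constant, so it does not see which row is deleted; this
    is what lets border and face maps commute. *)
Lemma border1_row' a b (M : 'M[R]_(a.+1, b)) i :
  border1 (row' i M) = row' i (border1 M).
Proof.
by apply/matrixP => s j; rewrite !mxE; case: unlift => //= k; rewrite mxE.
Qed.

(** Laplace expansion along the column of ones: the alternating sum over the
    faces becomes a single determinant. *)
Lemma det_border1 m (M : 'M[R]_(m.+1, m)) :
  \det (border1 M) = \sum_(i < m.+1) (-1) ^+ i * \det (row' i M).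
Proof.
rewrite (expand_det_col _ ord0); apply: eq_bigr => i _.
rewrite border1_0 mul1r /cofactor addn0; congr (_ * \det _).
by apply/matrixP => s j; rewrite !mxE liftK.
Qed.

(** The determinantal form of [d' \o d' = 0]: bordering twice produces two
    columns of ones. *)
Lemma sum_det_border1_row' m (M : 'M[R]_(m.+2, m)) :
  \sum_(i < m.+2) (-1) ^+ i * \det (border1 (row' i M)) = 0.
Proof.
under eq_bigr do rewrite border1_row'.
rewrite -det_border1 -det_tr.
apply: (@determinant_alternate _ _ _ ord0 (lift ord0 ord0)) => // i.
by rewrite mxE [RHS]mxE border1_0 border1_lift border1_0.
Qed.

Definition row_diff m (M : 'M[R]_(m.+1, m)) : 'M[R]_m :=
  \matrix_(s, j) (M (widen_ord (leqnSn m) s) j - M (lift ord0 s) j).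

(** Subtracting from each row the next one is left multiplication by a
    unipotent matrix. It clears the column of ones except in the last row, and
    that entry contributes the cofactor sign [(-1)^m]. *)
Lemma det_row_diff m (M : 'M[R]_(m.+1, m)) :
  \det (row_diff M) = (-1) ^+ m * \det (border1 M).
Proof.
pose U : 'M[R]_m.+1 := \matrix_(i, j) ((j == i)%:R - (j == i.+1 :> nat)%:R).
(* [U] is upper triangular, so its transpose is the one that [det_trig] sees. *)
have detU : \det U = 1.
  rewrite -det_tr det_trig.
    by rewrite big1 // => i _; rewrite !mxE eqxx (ltn_eqF (ltnSn i)) subr0.
  apply/is_trig_mxP => i j ij; rewrite !mxE -val_eqE /= !ltn_eqF ?subr0 //.
  exact: ltnW.
(* The last row of [U] has no entry off the diagonal: it is left unchanged. *)
have UB i j : (U *m border1 M) i j = border1 M i j -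
    (if unlift ord_max i is Some s then border1 M (lift ord0 s) j else 0).
  rewrite mxE; under eq_bigr do rewrite mxE mulrBl.
  rewrite sumrB (bigD1 i) //= eqxx mul1r big1 ?addr0; last first.
    by move=> k /negbTE->; rewrite mul0r.
  congr (_ - _); case: unliftP => [s ->|->].
    have bE : bump m s = s := lift_max s.
    rewrite (bigD1 (lift ord0 s)) //= big1 ?addr0; last first.
      move=> k kn; rewrite (_ : _ == _ = false) ?mul0r //.
      apply: contra_neqF kn => /eqP kE.
      by apply: ord_inj; rewrite kE bE lift0.
    by rewrite bE eqxx mul1r.
  by rewrite big1 // => k _; rewrite (ltn_eqF (ltn_ord k)) mul0r.
have -> : \det (border1 M) = \det (U *m border1 M).
  by rewrite det_mulmx detU mul1r.
rewrite (expand_det_col _ ord0) (bigD1 ord_max) //= big1 ?addr0; last first.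
  move=> i; case: (unliftP ord_max i) => [s -> _|->]; last by rewrite eqxx.
  by rewrite UB liftK !border1_0 subrr mul0r.
rewrite UB unlift_none subr0 border1_0 mul1r /cofactor /= addn0.
rewrite signrMK; congr (\det _).
apply/matrixP => s j; rewrite [LHS]mxE [RHS]mxE [RHS]mxE UB liftK.
rewrite !border1_lift; congr (M _ _ - _).
by apply: ord_inj; rewrite lift_max.
Qed.

End Determinants.

(** * Products of one-forms and translation-invariant forms *)

Section Forms.
Variables (R : realType) (n : nat).

(** By induction on the number of factors. Expanding the inner determinant over
    [t : 'S_p] writes the wedge as a sum over pairs [(s, t)]; extending [t] by a
    fixed point and composing it with [s] makes the summand depend on the
    composite only, so that each [t] contributes the same determinant. The
    resulting [p!] equal terms cancel the normalisation of [wedge]. *)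
Lemma wedge_prod_det q p (w : 'I_p -> preform R n q 1) g v :
  wedge_prod w g v = \det (\matrix_(i, j) w i g (fun=> v j)).
Proof.
elim: p w v => [|p IH] w v /=; first by rewrite det_mx00.
rewrite /wedge factS !mul1n.
transitivity (p`!%:R^-1 * \sum_(s : 'S_p.+1) \sum_(t : 'S_p)
  (-1) ^+ (lift_perm ord0 ord0 t * s)%g *
  \prod_i w i g (fun=> v ((lift_perm ord0 ord0 t * s)%g i))).
  congr (_ * _); apply: eq_bigr => s _; rewrite IH mulr_sumr.
  apply: eq_bigr => t _; rewrite big_ord_recl /= odd_permM odd_lift_perm /=.
  rewrite signr_addb.
  have -> : (fun i : 'I_1 => v (s (lshift p i))) =
            (fun=> v ((lift_perm ord0 ord0 t * s)%g ord0)).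
    apply/funext => i; rewrite ord1 permM lift_perm_id.
    by congr (v (s _)); apply: val_inj.
  rewrite [(-1) ^+ t * (-1) ^+ s]mulrC -!mulrA; congr (_ * _).
  rewrite mulrCA; congr (_ * (_ * _)); apply: eq_bigr => i _; rewrite mxE.
  rewrite permM lift_perm_lift; congr (w _ _ _); apply/funext => _.
  by congr (v (s _)); apply: val_inj.
rewrite exchange_big /=.
transitivity (p`!%:R^-1 * \sum_(t : 'S_p) 
  \det (\matrix_(i, j) w i g (fun=> v j))).
  congr (_ * _); apply: eq_bigr => t _.
  rewrite /determinant [RHS](reindex_inj (mulgI (lift_perm ord0 ord0 t))) /=.
  by apply: eq_bigr => s _; congr (_ * _); apply: eq_bigr => i _; rewrite mxE.
by rewrite sumr_const card_Sn -[X in _ * X]mulr_natl mulKf.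
Qed.

Lemma Ck_cst q k (c : R) : Ck k (fun _ : tangent R n q => c).
Proof.
elim: k c => [|k IH] c /=; first exact: cst_continuous.
split; first exact: cst_continuous.
move=> v; split=> [a|]; first exact: derivable_cst.
have -> : 'D_v (fun=> c) = fun=> 0 by apply/funext => a; rewrite derive_cst.
exact: IH.
Qed.

(** A form whose value does not depend on the point is smooth because its
    coefficients are constant; multilinearity and alternation are those of the
    determinant in its columns. *)
Lemma Omega_sum_det q r (c : R) (l : 'I_n -> 'I_r -> tangent R n q -> R) :
  (forall k i, scalar (l k i)) ->
  Omega (fun (_ : PT R n q) v =>
    c * \sum_k \det (\matrix_(i, j) l k i (v j))).
Proof.
move=> lin; split.
- move=> g v i a x y; rewrite mulrCA -mulrDr; congr (_ * _).
  rewrite mulr_sumr -big_split /=; apply: eq_bigr => k _.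
  rewrite -!(det_tr (\matrix_(_, _) _)) -[X in _ = _ + X]mul1r.
  have neq (z t : tangent R n q) :
      row' i (\matrix_(s, j) l k s (subst_vec v i z j))^T =
      row' i (\matrix_(s, j) l k s (subst_vec v i t j))^T.
    apply/matrixP => s j; rewrite !mxE /subst_vec.
    by rewrite eq_sym (negbTE (neq_lift _ _)).
  apply: (@determinant_multilinear _ _ _ _ _ i) => //.
  by apply/rowP => j; rewrite !mxE /subst_vec eqxx mul1r lin.
- move=> g v i j ij vij; rewrite big1 ?mulr0 // => k _; rewrite -det_tr.
  by apply: (determinant_alternate ij) => s; rewrite !mxE vij.
- by move=> v k; apply: Ck_cst.
Qed.

Lemma Omega0 q r : Omega (0 : preform R n q r).
Proof.
split=> [g v i a x y | // | v k]; last exact: (Ck_cst q k (0 : R)).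
by rewrite mulr0 addr0.
Qed.

(** The invariant vector fields differentiate the coefficients of [w], which are
    constant functions. *)
Lemma d''_invariant q r (w : preform R n q r) :
  (forall g h, w g = w h) -> d'' w = 0.
Proof.
move=> inv; apply/funext => g; apply/funext => v; rewrite /d'' /ext_diff.
rewrite !fctE big1 ?scaler0 // => i _; rewrite /PT_derive.
under eq_fun do rewrite (inv _ g).
by rewrite derive1_cst mulr0.
Qed.

Lemma scale_sum_preformE q r c (w : 'I_n -> preform R n q r) g v :
  (c *: \sum_k w k) g v = c * \sum_k w k g v.
Proof. by rewrite !fctE !fct_sumE. Qed.

Lemma d'E q r (w : preform R n q r) g v :
  d' w g v = \sum_(i < q.+2) (-1) ^+ i * w (face i g) (fun j => row' i (v j)).
Proof. by rewrite /d' !fct_sumE. Qed.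

Lemma d'0 q r : d' (0 : preform R n q r) = 0.
Proof.
apply/funext => g; apply/funext => v.
by rewrite d'E big1 // => i _; rewrite mulr0.
Qed.

(** * Families concentrated in one bidegree *)

Lemma single_id q r (w : preform R n q r) : single w q r = w.
Proof.
rewrite /single; case: eqP => // e.
(* The cast is along a proof of [(q, r) = (q, r)], hence trivial. *)
by rewrite (eq_axiomK e).
Qed.

Lemma single_neq q r (w : preform R n q r) q' r' :
  (q, r) <> (q', r') -> single w q' r' = 0.
Proof. by rewrite /single; case: eqP. Qed.

(** For a [d'']-closed form the total differential has only the component [d'],
    so equations between families reduce to one bidegree. *)
Lemma D_single q r (w : preform R n q r) :
  d'' w = 0 -> D (single w) = single (d' w).
Proof.
move=> dw; apply: functional_extensionality_dep => q'.
apply: functional_extensionality_dep => r'; rewrite /D.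
have -> : (match r' return preform R n q' r' with
           | 0 => 0 | r0.+1 => d'' (single w q' r0) end) = 0.
  case: r' => // r'; have [[<- <-]|ne] := pselect ((q, r) = (q', r')).
    by rewrite single_id.
  by rewrite single_neq // d''_invariant.
rewrite addr0; case: q' => [|q']; first by rewrite single_neq.
have [[<- <-]|ne] := pselect ((q, r) = (q', r')); first by rewrite !single_id.
by rewrite !single_neq ?d'0 // => -[eq er]; apply: ne; rewrite eq er.
Qed.

Lemma single0 q r : single (0 : preform R n q r) = @total_zero R n.
Proof.
apply: functional_extensionality_dep => q'.
apply: functional_extensionality_dep => r'.
have [[<- <-]|ne] := pselect ((q, r) = (q', r')); first by rewrite single_id.
by rewrite single_neq.
Qed.

Lemma cochain_single q r (w : preform R n q r) :
  Omega w -> cochain (q + r) (single w).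
Proof.
move=> Ow; split=> q' r'.
  have [[<- <-]|ne] := pselect ((q, r) = (q', r')); first by rewrite single_id.
  by rewrite single_neq //; apply: Omega0.
by move=> ne; apply: single_neq => -[eq er]; rewrite eq er eqxx in ne.
Qed.

(** * The two forms in angle coordinates *)

Definition angle_mx q r (v : 'I_r -> tangent R n q) (k : 'I_n) :
    'M[R]_(q.+1, r) :=
  \matrix_(s, j) v j s k.

Lemma angle_mx_face q r (i : 'I_q.+2) (v : 'I_r -> tangent R n q.+1) k :
  angle_mx (fun j => row' i (v j)) k = row' i (angle_mx v k).
Proof. by apply/matrixP => s j; rewrite !mxE. Qed.

(** The normalisations of the two forms agree up to sign; this is their common
    absolute value. *)
Definition chern_coef p : R := p`!%:R^-1 * (1 / (2 * pi)) ^+ p.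

(** The exponent is split as [p(p+1)/2 = p(p-1)/2 + p], for [p.+1] in place of
    [p], to isolate the sign that [det_row_diff] accounts for. *)
Lemma T_omega_barE p g v : T_omega_bar R n p.+1 g v =
  (-1) ^+ (p.+1 * p)./2 * (-1) ^+ p.+1 * chern_coef p.+1 *
    \sum_k \det (angle_mx v k).
Proof.
rewrite /T_omega_bar /chern_coef.
have -> : ((p.+1 * (p.+1 + 1))./2 = (p.+1 * p)./2 + p.+1)%N.
  have -> : (p.+1 * (p.+1 + 1) = p.+1 * p + p.+1.*2)%N.
    by rewrite -muln2 -mulnDr addn1 addn2.
  by rewrite halfD odd_double andbF doubleK.
rewrite exprD scale_sum_preformE -!mulrA; do 4!congr (_ * _).
apply: eq_bigr => k _; rewrite wedge_prod_det; congr (\det _).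
apply/matrixP => s j; rewrite !mxE /dtheta; congr (v j _ k); exact: val_inj.
Qed.

Lemma omega_barE_diff p g v : omega_bar R n p g v =
  (-1) ^+ (p * p.-1)./2 * chern_coef p * \sum_k \det (row_diff (angle_mx v k)).
Proof.
rewrite /omega_bar /chern_coef subn1 scale_sum_preformE -!mulrA.
do 3!congr (_ * _).
apply: eq_bigr => k _; rewrite wedge_prod_det; congr (\det _).
by apply/matrixP => s j; rewrite !mxE.
Qed.

(** In this shape the form is compared with [d'] of the Chern-Simons form, and
    its own [d'] is seen to vanish. *)
Lemma omega_barE p g v : omega_bar R n p g v =
  (-1) ^+ (p * p.-1)./2 * (-1) ^+ p * chern_coef p *
    \sum_k \det (border1 (angle_mx v k)).
Proof.
rewrite omega_barE_diff; under eq_bigr do rewrite det_row_diff.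
by rewrite -mulr_sumr mulrA; congr (_ * _); rewrite mulrAC.
Qed.

Lemma Omega_T_omega_bar p : Omega (T_omega_bar R n p.+1).
Proof.
have -> : T_omega_bar R n p.+1 = fun _ v =>
    (-1) ^+ (p.+1 * p)./2 * (-1) ^+ p.+1 * chern_coef p.+1 *
      \sum_k \det (\matrix_(s, j) v j s k).
  by apply/funext => g; apply/funext => v; apply: T_omega_barE.
apply: (Omega_sum_det _ (l := fun k s x => x s k)) => k s a x y.
by rewrite !mxE.
Qed.

Lemma Omega_omega_bar p : Omega (omega_bar R n p).
Proof.
pose l k s (x : tangent R n p) :=
  x (widen_ord (leqnSn p) s) k - x (lift ord0 s) k.
have -> : omega_bar R n p = fun _ v =>
    (-1) ^+ (p * p.-1)./2 * chern_coef p *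
      \sum_k \det (\matrix_(s, j) l k s (v j)).
  apply/funext => g; apply/funext => v; rewrite omega_barE_diff; congr (_ * _).
  apply: eq_bigr => k _; congr (\det _).
  by apply/matrixP => s j; rewrite !mxE.
apply: Omega_sum_det => k s a x y.
by rewrite /l !mxE /GRing.scale /= mulrBr opprD addrACA.
Qed.

Lemma d'_T_omega_bar p : d' (T_omega_bar R n p.+1) = omega_bar R n p.+1.
Proof.
apply/funext => g; apply/funext => v; rewrite d'E omega_barE.
under eq_bigr do rewrite T_omega_barE mulrCA.
rewrite -mulr_sumr; congr (_ * _).
under eq_bigr do rewrite mulr_sumr.
rewrite exchange_big /=; apply: eq_bigr => k _; rewrite det_border1.
by apply: eq_bigr => i _; rewrite angle_mx_face.
Qed.

Lemma d'_omega_bar p : d' (omega_bar R n p) = 0.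
Proof.
apply/funext => g; apply/funext => v; rewrite d'E.
under eq_bigr do rewrite omega_barE mulrCA.
rewrite -mulr_sumr; under eq_bigr do rewrite mulr_sumr.
rewrite exchange_big /= big1 ?mulr0 // => k _.
rewrite -[RHS](sum_det_border1_row' (angle_mx v k)).
by apply: eq_bigr => i _; rewrite angle_mx_face.
Qed.

End Forms.

Theorem theorem3p2 (R : realType) (n p : nat) (hn : (1 <= n)%N)
    (hp : (1 <= p)%N) :
  [/\ Omega (T_omega_bar R n p),
      Omega (omega_bar R n p),
      D (single (T_omega_bar R n p)) = single (omega_bar R n p)
    & chern_simons_form (p.-1 + p)%N
        (single (omega_bar R n p)) (single (T_omega_bar R n p))].
Proof.
case: p hp => // p _.
have OT := Omega_T_omega_bar R n p; have Ow := Omega_omega_bar R n p.+1.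
have DT : D (single (T_omega_bar R n p.+1)) = single (omega_bar R n p.+1).
  rewrite D_single ?d'_T_omega_bar //; apply: d''_invariant => g h.
  by apply/funext => v; rewrite !T_omega_barE.
have Dw : D (single (omega_bar R n p.+1)) = @total_zero R n.
  rewrite D_single ?d'_omega_bar ?single0 //; apply: d''_invariant => g h.
  by apply/funext => v; rewrite !omega_barE.
split=> //; split=> //; last exact: cochain_single.
by split=> //; apply: (cochain_single Ow).
Qed.
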